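(* Let $\{a_n\}_{n\ge 1}$ be a sequence of positive real numbers and let $m\geq 1$ be any fixed positive integer. If there exist a sequence $\{q_n\}_{n\ge 1}$ of positive real numbers and a real number $c>0$ such that $$q_n\frac{a_n}{a_{n+m}}-q_{n+m}\geq c$$ for all $n$ sufficiently large, then $\sum a_n$ converges. Conversely, if $\sum a_n$ converges, then there exist a sequence $\{q_n\}_{n\ge1}$ of positive real numbers and a real number $c>0$ such that $$q_n\frac{a_n}{a_{n+m}}-q_{n+m}\geq c$$ for all $n$ sufficiently large. *)

(* Defs.v *)
From Stdlib Require Export Reals.
From Coquelicot Require Export Coquelicot.

(** A sequence [x_1, x_2, ...] is a function [x : nat -> R] whose value at [0]
    plays no role; accordingly its series is [ex_series (fun n => x (S n))]. *)
Definition pos_seq (x : nat -> R) : Prop :=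
  forall n : nat, (1 <= n)%nat -> (0 < x n)%R.

(* Main.v *)
Require Import Defs.
From Stdlib Require Import Reals Lra Lia.
From Coquelicot Require Import Coquelicot.
Open Scope R_scope.

(** Put [b n = q n * a n].  Multiplied by [a (n + m)], the condition on [q]
    becomes [b n - b (n + m) >= c * a (n + m)], a bound of the terms of the
    series by differences of step [m].

    Such a difference is also one of step [1]: with
    [W n = b n + ... + b (n + m - 1)], the sliding window of length [m], one has
    [W n - W (n + 1) = b n - b (n + m)] ([window_sum_diff]).  As [W] is positive,
    the sums of [c * a (n + m)] telescope and stay below the first value of [W],
    which gives convergence ([ex_series_le_decrements]).

    Conversely, for a convergent series let [b n] be the tail
    [a (n + 1) + a (n + 2) + ...], that is [q n = b n / a n].  Then
    [b n - b (n + m) = a (n + 1) + ... + a (n + m) >= a (n + m)], so [c = 1]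
    works.  The full tail serves for every [m]: there is no need to split the
    series along the residue classes modulo [m]. *)

Lemma sum_n_succ (u : nat -> R) (n : nat) : sum_n u (S n) = sum_n u n + u (S n).
Proof. exact (sum_Sn u n). Qed.

(** Telescoping: the partial sums of [u] are at most [W 0]. *)
Lemma ex_series_le_decrements (u W : nat -> R) :
  (forall n, 0 <= u n) -> (forall n, 0 <= W n) ->
  (forall n, u n <= W n - W (S n)) ->
  ex_series u.
Proof.
  intros u_ge0 W_ge0 u_le.
  assert (sum_le : forall n, sum_n u n <= W O - W (S n)).
  { induction n as [|n IHn].
    - rewrite sum_O; apply u_le.
    - rewrite sum_n_succ.
      specialize (u_le (S n)); lra. }
  destruct (ex_finite_lim_seq_incr (sum_n u) (W O)) as [l l_lim].
  - intros n; rewrite sum_n_succ.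
    specialize (u_ge0 (S n)); lra.
  - intros n; specialize (sum_le n); specialize (W_ge0 (S n)); lra.
  - exists l; exact l_lim.
Qed.

(** The windows of length [p + 1] at [n] and at [n + 1] differ only by their
    extreme terms. *)
Lemma window_sum_diff (b : nat -> R) (n p : nat) :
  sum_n (fun i => b (n + i)%nat) p - sum_n (fun i => b (S n + i)%nat) p
  = b n - b (n + S p)%nat.
Proof.
  induction p as [|p IHp].
  - rewrite !sum_O.
    now replace (n + 0)%nat with n by lia; replace (n + 1)%nat with (S n + 0)%nat by lia.
  - rewrite !sum_n_succ.
    replace (n + S (S p))%nat with (S n + S p)%nat by lia; lra.
Qed.

Lemma sum_n_nonneg (u : nat -> R) (n : nat) :
  (forall i, 0 <= u i) -> 0 <= sum_n u n.
Proof.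
  intros u_ge0; induction n as [|n IHn].
  - rewrite sum_O; apply u_ge0.
  - rewrite sum_n_succ; specialize (u_ge0 (S n)); lra.
Qed.

(** The tail is strict, starting after [n], so that going from [n] to [n + m]
    loses the term of index [n + m] itself. *)
Definition tail (a : nat -> R) (n : nat) : R := Series (fun k => a (S n + k)%nat).

Section Tail.

Variable a : nat -> R.
Hypothesis a_pos : pos_seq a.
Hypothesis a_sum : ex_series (fun n => a (S n)).

Lemma ex_series_tail (n : nat) : ex_series (fun k => a (S n + k)%nat).
Proof. exact (proj1 (ex_series_incr_n (fun k => a (S k)) n) a_sum). Qed.

Lemma tail_step (n : nat) : tail a n = a (S n) + tail a (S n).
Proof.
  unfold tail; rewrite Series_incr_1 by apply ex_series_tail.
  f_equal.
  - f_equal; lia.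
  - apply Series_ext; intros k; f_equal; lia.
Qed.

Lemma tail_nonneg (n : nat) : 0 <= tail a n.
Proof.
  unfold tail.
  replace 0 with (Series (fun k => 0 * a (S n + k)%nat))
    by (rewrite Series_scal_l; ring).
  apply Series_le; [|apply ex_series_tail].
  intros k; assert (0 < a (S n + k)%nat) by (apply a_pos; lia); lra.
Qed.

Lemma tail_pos (n : nat) : 0 < tail a n.
Proof.
  rewrite tail_step.
  assert (0 < a (S n)) by (apply a_pos; lia).
  pose proof (tail_nonneg (S n)); lra.
Qed.

Lemma tail_decr (n p : nat) : tail a (n + p) <= tail a n.
Proof.
  induction p as [|p IHp].
  - rewrite Nat.add_0_r; lra.
  - rewrite Nat.add_succ_r.
    assert (0 < a (S (n + p))) by (apply a_pos; lia).
    pose proof (tail_step (n + p)); lra.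
Qed.

(** Among the terms [a (n + 1), ..., a (n + p + 1)] that separate the two tails,
    only the last one is kept. *)
Lemma tail_diff_ge (n p : nat) :
  a (n + S p)%nat <= tail a n - tail a (n + S p).
Proof.
  rewrite Nat.add_succ_r.
  pose proof (tail_step (n + p)); pose proof (tail_decr n p); lra.
Qed.

End Tail.

Theorem theorem2p1 (a : nat -> R) (m : nat) (ha : pos_seq a) (hm : (1 <= m)%nat) :
  ((exists (q : nat -> R) (c : R),
      pos_seq q /\ 0 < c /\
      eventually (fun n : nat => q n * (a n / a (n + m)%nat) - q (n + m)%nat >= c)) ->
   ex_series (fun n : nat => a (S n)))
  /\
  (ex_series (fun n : nat => a (S n)) ->
   exists (q : nat -> R) (c : R),
     pos_seq q /\ 0 < c /\
     eventually (fun n : nat => q n * (a n / a (n + m)%nat) - q (n + m)%nat >= c)).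
Proof.
  destruct m as [|p]; [lia|].
  split.
  - intros (q & c & q_pos & c_pos & N & q_ge).
    set (b := fun n => q n * a n).
    assert (b_ge0 : forall n, (1 <= n)%nat -> 0 <= b n).
    { intros n n_ge1.
      apply Rlt_le, Rmult_lt_0_compat; [apply q_pos | apply ha]; exact n_ge1. }
    assert (b_diff : forall n, (N <= n)%nat ->
              c * a (n + S p)%nat <= b n - b (n + S p)%nat).
    { intros n n_geN; unfold b.
      assert (a_gt0 : 0 < a (n + S p)%nat) by (apply ha; lia).
      replace (q n * a n - q (n + S p)%nat * a (n + S p)%nat)
        with ((q n * (a n / a (n + S p)%nat) - q (n + S p)%nat) * a (n + S p)%nat)
        by (field; lra).
      apply Rmult_le_compat_r; [lra|].
      apply Rge_le, q_ge, n_geN. }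
    (* The windows start at index [S N], where the condition holds and the index
       [0], at which [b] has no sign, is avoided. *)
    apply (ex_series_incr_n (fun n => a (S n)) (N + S p)).
    apply (ex_series_le_decrements _
             (fun n => / c * sum_n (fun i => b (S N + n + i)%nat) p)).
    + intros n; apply Rlt_le, ha; lia.
    + intros n; apply Rmult_le_pos.
      * apply Rlt_le, Rinv_0_lt_compat, c_pos.
      * apply sum_n_nonneg; intros i; apply b_ge0; lia.
    + intros n.
      replace (S N + S n)%nat with (S (S N + n)) by lia.
      rewrite <- Rmult_minus_distr_l, window_sum_diff.
      replace (S (N + S p + n)) with (S N + n + S p)%nat by lia.
      apply (Rmult_le_reg_l c); [exact c_pos|].
      rewrite <- Rmult_assoc, Rinv_r, Rmult_1_l by lra.
      apply b_diff; lia.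
  - intros a_sum.
    exists (fun n => tail a n / a n), 1.
    split; [|split; [lra|]].
    + intros n n_ge1.
      apply Rdiv_lt_0_compat; [apply tail_pos; assumption | apply ha, n_ge1].
    + (* The quotient cancels only where [a n] is known to be nonzero, hence
         from [n = 1] on. *)
      exists 1%nat; intros n n_ge1; apply Rle_ge.
      assert (an_gt0 : 0 < a n) by (apply ha, n_ge1).
      assert (am_gt0 : 0 < a (n + S p)%nat) by (apply ha; lia).
      replace (tail a n / a n * (a n / a (n + S p)%nat)
               - tail a (n + S p) / a (n + S p)%nat)
        with ((tail a n - tail a (n + S p)) / a (n + S p)%nat)
        by (field; lra).
      apply (Rmult_le_reg_r (a (n + S p)%nat)); [exact am_gt0|].
      unfold Rdiv; rewrite Rmult_assoc, Rinv_l, Rmult_1_l, Rmult_1_r by lra.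
      apply tail_diff_ge; assumption.
Qed.
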